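(* Let $f$ be a spectral density which is bounded away from zero and whose autocovariance satisfies $\sum_{r\in\mathbb{Z}}|r\,c_f(r)|<\infty$, and let $\Gamma_n(f)$ denote the $n\times n$ Toeplitz matrix generated by $f$, i.e. $\Gamma_n(f)_{s,t}=c_f(s-t)$. Then $$\Gamma_{n}(f)^{-1}=F_{n}^{*}\Delta_{n}(f^{-1})\big(F_{n}+D_{n}(f)\big),$$ where $D_n(f)$ is the $n\times n$ matrix with entries $$D_{n}(f)_{k,t}= n^{-1/2}\sum_{\tau\leq 0}\left(\phi_{t,n}(\tau;f)e^{i\tau\omega_{k,n}}+\phi_{n+1-t,n}(\tau;f)e^{-i(\tau-1)\omega_{k,n}}\right).$$ In particular, if $f_1$ and $f_2$ are two such spectral densities with the same autocovariances up to lag $n-1$, then $$\Gamma_{n}(f_1)^{-1}=F_{n}^{*}\Delta_{n}(f_1^{-1})(F_{n}+D_{n}(f_1))=F_{n}^{*}\Delta_{n}(f_2^{-1})(F_{n}+D_{n}(f_2))=\Gamma_{n}(f_2)^{-1}.$$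
   Context: $c_f(r)$, $r\in\mathbb{Z}$, is the autocovariance function of a real-valued zero mean second order stationary time series $\{X_t\}$ with spectral density $f(\omega)=\sum_{r\in\mathbb{Z}}c_f(r)e^{ir\omega}$. $\omega_{k,n}=2\pi k/n$; $F_n$ is the $n\times n$ matrix with entries $(F_n)_{k,t}=n^{-1/2}e^{it\omega_{k,n}}$; $F_n^*$ is its conjugate transpose; $\Delta_n(g)=\mathrm{diag}(g(\omega_{1,n}),\ldots,g(\omega_{n,n}))$. For $\tau\le 0$, $\{\phi_{t,n}(\tau;f)\}_{t=1}^n$ are the coefficients minimizing $\mathbb{E}_f[X_\tau-\sum_{t=1}^{n}\phi_{t,n}(\tau;f)X_t]^2$, i.e. the coefficients of the best linear predictor of $X_\tau$ given $X_1,\ldots,X_n$ when the autocovariance is $c_f$. *)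

(* Defs.v *)
From HB Require Import structures.
From mathcomp Require Import all_boot all_order all_algebra.
From mathcomp Require Import complex.
From mathcomp Require Import all_classical all_reals all_analysis.

Set Implicit Arguments.
Unset Strict Implicit.
Unset Printing Implicit Defensive.

Import Order.TTheory GRing.Theory Num.Theory.
Import numFieldNormedType.Exports.

Local Open Scope classical_set_scope.
Local Open Scope ring_scope.
Local Open Scope complex_scope.
Local Open Scope sesquilinear_scope.

Section Fourier.
Context {R : realType}.

(* e^{ix} *)
Definition expi (x : R) : R[i] := cos x +i* sin x.

(* \sum_(r in Z) u r = l, as the limit of the sums over -N <= r <= N;
   for the absolutely summable families used here the order is immaterial.
   The topology of R[i] is the one of its modulus, which the library attaches
   to R[i]^o. *)
Definition sumZ_is (u : int -> R[i]) (l : R[i]) : Prop :=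
  (fun N : nat => \sum_(i < N.*2.+1) u (i%:Z - N%:Z) : R[i]^o) @ \oo
    --> (l : R[i]^o).

(* That f is real-valued is part of this condition. *)
Definition is_spectral_density (c : int -> R) (f : R -> R) : Prop :=
  forall w : R, sumZ_is (fun r => (c r)%:C * expi (r%:~R * w)) (f w)%:C.

Definition bounded_away_from_zero (f : R -> R) : Prop :=
  exists2 delta : R, 0 < delta & forall w : R, delta <= f w.

Definition summable_lag_acv (c : int -> R) : Prop :=
  summable [set: int] (fun r => (r%:~R * c r)%:E).

(* Ordinals of 'I_n start at 0, whereas the frequencies, rows, columns and
   observation times run over 1, ..., n: the ordinal k stands for k.+1. *)
Definition freq (n : nat) (k : 'I_n) : R := 2 * pi * k.+1%:R / n%:R.

Definition DFT (n : nat) : 'M[R[i]]_n :=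
  \matrix_(k, t) ((Num.sqrt n%:R)^-1%:C * expi (t.+1%:R * freq k)).

Definition Delta (n : nat) (g : R -> R) : 'M[R[i]]_n :=
  diag_mx (\row_k (g (freq k))%:C).

Definition Gamma (n : nat) (c : int -> R) : 'M[R[i]]_n :=
  \matrix_(s, t) (c (s%:Z - t%:Z))%:C.

End Fourier.

Section Prediction.
Context {R : realType} {d : measure_display} {T : measurableType d}.
Variables (P : probability T R) (X : int -> {RV P >-> R}).

Record is_stationary_with_acv (c : int -> R) : Prop := {
  acv_square_integrable : forall t, (X t : T -> R) \in Lfun P 2%:E ;
  acv_zero_mean : forall t, ('E_P[X t] = 0)%E ;
  acv_covariance : forall s t, covariance P (X s) (X t) = (c (s - t))%:E }.

Record has_regular_spectrum (c : int -> R) (f : R -> R) : Prop := {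
  spec_stationary : is_stationary_with_acv c ;
  spec_density : is_spectral_density c f ;
  spec_away0 : bounded_away_from_zero f ;
  spec_summable : summable_lag_acv c }.

Variable n : nat.

Definition pred_mse (tau : int) (a : 'rV[R]_n) : \bar R :=
  'E_P[(fun w => (X tau w - \sum_(t < n) a 0 t * X t.+1%:Z w) ^+ 2)%R]%E.

Definition is_best_linear_predictor (tau : int) (a : 'rV[R]_n) : Prop :=
  forall b : 'rV[R]_n, (pred_mse tau a <= pred_mse tau b)%E.

Definition blp_coef (tau : int) : 'rV[R]_n :=
  xget 0 [set a | is_best_linear_predictor tau a].

(* [rev_ord t] stands for the time n + 1 - (t + 1). *)
Definition D_term (k t : 'I_n) (tau : int) : R[i] :=
  (blp_coef tau 0 t)%:C * expi (tau%:~R * freq k)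
  + (blp_coef tau 0 (rev_ord t))%:C * expi (- (tau - 1)%:~R * freq k).

(* The series over tau <= 0, with tau = - j. *)
Definition D_series (k t : 'I_n) : (R[i]^o) ^nat :=
  series (fun j : nat => D_term k t (- j%:Z) : R[i]^o).

Definition D_mx : 'M[R[i]]_n :=
  \matrix_(k, t) ((Num.sqrt n%:R)^-1%:C * limn (D_series k t)).

End Prediction.

(* Main.v *)
Require Import Defs.
From HB Require Import structures.
From mathcomp Require Import all_boot all_order all_algebra.
From mathcomp Require Import complex.
From mathcomp Require Import all_classical all_reals all_analysis.
From mathcomp Require Import ring lra zify.

Set Implicit Arguments.
Unset Strict Implicit.

Import Order.TTheory GRing.Theory Num.Theory.
Import numFieldNormedType.Exports.

Local Open Scope classical_set_scope.
Local Open Scope ring_scope.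
Local Open Scope complex_scope.
Local Open Scope sesquilinear_scope.

(** Write G for the Toeplitz matrix of c, F for the Fourier matrix and F^* for
    its conjugate transpose.  Since F is unitary and f never vanishes, the
    inversion formula amounts to D = Delta(f) F G^-1 - F ([D_mxE]), that is, to
    (F + D) G = Delta(f) F.

    The coefficients phi(tau) of the best linear predictor of X_tau solve the
    normal equations phi(tau) G = (c(tau - s))_s ([best_linear_predictorP]).
    Reversing time in these equations shows that the coefficients of X_tau,
    read backwards, are those of X_(n+1-tau) ([lag_row_rev]).  So both halves of
    D are of the same kind: at w = 2 pi k / n the sum defining D runs over all
    times tau outside 1, ..., n, with weights e^(i tau w), because e^(i n w) = 1.
    Multiplying by G turns each phi_t(tau) into c(tau - s); the row of F G
    supplies the same sum over tau = 1, ..., n.  Together they form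
    sum_(tau in Z) c(tau - s) e^(i tau w) = e^(i s w) f(w)
    ([cvg_window_sum], [cvg_outside_sum]), the entry of Delta(f) F up to the
    factor n^(-1/2).

    Positive definiteness of G comes from the same identity.  The prediction
    error of X_tau by l * y is c 0 - 2 l <(c(tau - s))_s, y> + l^2 y G y^T, and
    it is nonnegative for every l; if y G y^T <= 0, the linear term must vanish
    for every tau in Z, so the convolution of c with y is zero.  Taking Fourier
    series, f(w) times the Fourier transform of y is zero at each frequency,
    hence F y = 0 and y = 0 ([toeplitz_posdef]).

    The last claim holds because G involves only the lags up to n - 1. *)

(** * The character e^(ix) and the unitary Fourier matrix *)

Section Expi.
Context {R : realType}.
Implicit Types x y : R.

Lemma expi0 : expi (0 : R) = 1.
Proof. by rewrite /expi cos0 sin0. Qed.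

Lemma expiD x y : expi (x + y) = expi x * expi y.
Proof.
rewrite /expi cosD sinD; apply/eqP; rewrite eq_complex /=.
by apply/andP; split; apply/eqP; ring.
Qed.

Lemma expi_conj x : (expi x)^*%R = expi (- x).
Proof. by rewrite /expi cosN sinN. Qed.

Lemma expiX x m : expi x ^+ m = expi (m%:R * x).
Proof.
elim: m => [|m IH]; first by rewrite mul0r expi0.
by rewrite exprS IH -expiD -natr1 mulrDl mul1r addrC.
Qed.

Lemma expi2pi : expi (2 * pi : R) = 1.
Proof. by rewrite /expi mulrC mulr_natr cos2pi sin2pi. Qed.

(** cos x = 1 - 2 sin^2(x/2), and the sine is positive on the open interval
    from 0 to pi. *)
Lemma expi_eq1 x : 0 <= x < 2 * pi -> expi x = 1 -> x = 0.
Proof.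
move=> /andP[x0 x2pi] /(congr1 (@complex.Re _)) /= cosx.
apply/eqP; rewrite eq_le x0 andbT leNgt; apply/negP => xgt0.
have sx : 0 < sin (x / 2).
  by apply: sin_gt0_pi; rewrite divr_gt0//= ltr_pdivrMr// mulrC.
have : cos (x / 2 *+ 2) = 1 by rewrite -mulr_natr mulfVK.
rewrite cos_mulr2n cos2sin2.
have : 0 < sin (x / 2) ^+ 2 by rewrite exprn_gt0.
lra.
Qed.

End Expi.

Section DFT_unitary.
Context {R : realType} (n : nat).
Hypothesis n_gt0 : (0 < n)%N.

Lemma freq_period (k : 'I_n) : expi (n%:R * freq k) = 1 :> R[i].
Proof.
have n0 : n%:R != 0 :> R by rewrite pnatr_eq0 -lt0n.
rewrite /freq mulrC divfK//.
by rewrite [X in expi X]mulrC -expiX expi2pi expr1n.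
Qed.

Lemma expi_freq_inj : injective (fun k : 'I_n => expi (freq k) : R[i]).
Proof.
have n0 : 0 < n%:R :> R by rewrite ltr0n.
have key (k l : 'I_n) : (l <= k)%N -> expi (freq k : R) = expi (freq l) -> k = l.
  move=> lk /= e; apply/val_inj => /=.
  have {e} : expi (freq k - freq l : R) = 1.
    by rewrite expiD e -expiD subrr expi0.
  move=> /expi_eq1; rewrite -mulrBl -mulrBr -natrB ?ltnS// subSS.
  have := ltn_ord k; case: l lk => l /= _ lk kn /(_ _)/eqP H.
  have {}H : 0 <= 2 * (pi : R) * (k - l)%:R / n%:R < 2 * pi -> (k - l == 0)%N.
    move=> /H; rewrite !mulf_eq0 invr_eq0 (gt_eqF n0) (gt_eqF (pi_gt0 R)).
    by rewrite !pnatr_eq0 orbF.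
  suff : (k - l == 0)%N by lia.
  apply: H; rewrite !mulr_ge0 ?pi_ge0 ?invr_ge0 ?(ltW n0)//=.
  rewrite ltr_pdivrMr// ltr_pM2l ?mulr_gt0 ?pi_gt0// ltr_nat; lia.
move=> k l /= e; have [lk|/ltnW kl] := leqP l k; first exact: key.
by apply/esym/key.
Qed.

(** Off the diagonal the entry is a geometric sum of ratio z = e^(i(w_k - w_l)),
    a nontrivial n-th root of unity. *)
Lemma DFT_unitary : (DFT n : 'M[R[i]]_n) *m (DFT n)^t* = 1%:M.
Proof.
have n0 : n%:R != 0 :> R by rewrite pnatr_eq0 -lt0n.
apply/matrixP => k l; rewrite !mxE.
have -> : \sum_j (DFT n : 'M[R[i]]_n) k j * (DFT n)^t* j l
    = (n%:R^-1)%:C * \sum_(j < n) expi (freq k - freq l) ^+ j.+1.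
  rewrite mulr_sumr; apply: eq_bigr => j _; rewrite !mxE rmorphM /= expi_conj.
  rewrite expiX mulrBr expiD.
  have -> : ((Num.sqrt n%:R)^-1%:C)^*%R = (Num.sqrt n%:R)^-1%:C :> R[i].
    exact: conjc_real.
  rewrite mulrACA -rmorphM -invfM -expr2 sqr_sqrtr ?ler0n//.
case: (altP (k =P l)) => [->|kl] /=.
  rewrite subrr expi0; under eq_bigr do rewrite expr1n.
  by rewrite sumr_const card_ord -(rmorph_nat (@real_complex R)) -rmorphM mulVf.
set z := expi _.
have z1 : z != 1.
  apply: contra kl => /eqP z1; apply/eqP/expi_freq_inj => /=.
  by rewrite -[freq k](subrK (freq l)) expiD -/z z1 mul1r.
have zn : z ^+ n = 1.
  rewrite /z expiX mulrBr expiD freq_period mul1r -expi_conj freq_period.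
  by rewrite -[RHS](rmorph1 (Num.conj : R[i] -> R[i])).
under eq_bigr do rewrite exprS.
rewrite -mulr_sumr; have := subrX1 z n; rewrite zn subrr => /esym/eqP.
by rewrite mulf_eq0 subr_eq0 (negPf z1) /= => /eqP ->; rewrite !mulr0.
Qed.

End DFT_unitary.

(** * Limits of complex sequences *)

Section ComplexLimits.
Context {R : realType}.

Lemma cvg_real_complex (u : nat -> R) (a : R) : u @ \oo --> a ->
  (fun N => (u N)%:C : R[i]^o) @ \oo --> (a%:C : R[i]^o).
Proof.
move=> /cvgrPdist_lt ua; apply/cvgrPdist_lt => e e0.
have eR : (complex.Re e)%:C = e by rewrite RRe_real// gtr0_real.
move: e0; rewrite -eR ltcR => /ua; apply: filterS => N.
rewrite -rmorphB /= normc_def /= expr0n /= addr0 sqrtr_sqr ltcR//.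
Qed.

Lemma cvg_complex (u v : nat -> R) (a b : R) :
  u @ \oo --> a -> v @ \oo --> b ->
  (fun N => u N +i* v N : R[i]^o) @ \oo --> (a +i* b : R[i]^o).
Proof.
move=> /cvg_real_complex ua /cvg_real_complex vb.
rewrite [X in _ --> X](_ : _ = a%:C + 'i * b%:C :> R[i]); last first.
  by simpc.
apply: cvg_trans (cvgD ua (cvgMl_tmp (a := 'i : R[i]) vb)).
apply: near_eq_cvg; apply: nearW => N /=.
by rewrite fctE; simpc.
Qed.

Lemma cvg_lincomb (I : finType) (a : I -> R[i]) (F : I -> nat -> R[i])
    (l : I -> R[i]) :
  (forall i, F i @ \oo --> (l i : R[i]^o)) ->
  (fun N => \sum_i a i * F i N : R[i]^o) @ \oo --> (\sum_i a i * l i : R[i]^o).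
Proof.
move=> Fl; apply: cvg_big => [|i _]; first exact: add_continuous.
exact: cvgMl_tmp (Fl i).
Qed.

Lemma cvg_complex_shift (u : nat -> R[i]) (a : R[i]) m :
  u @ \oo --> (a : R[i]^o) -> (fun N => u (N + m)%N : R[i]^o) @ \oo --> (a : R[i]^o).
Proof. by move=> ua; rewrite (@cvg_shiftn m R[i]^o). Qed.

Lemma cvg_complex_unique (u : nat -> R[i]) (a b : R[i]) :
  u @ \oo --> (a : R[i]^o) -> u @ \oo --> (b : R[i]^o) -> a = b.
Proof.
move=> ua ub; have H := @cvg_lim (R[i]^o) (@norm_hausdorff _ _).
by rewrite -(H _ _ _ _ _ ua) -(H _ _ _ _ _ ub).
Qed.

End ComplexLimits.

(** * Fourier series of a summable autocovariance *)

Section Fourier.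
Context {R : realType}.

(** The real and the imaginary parts are dominated by the series of |u j|. *)
Lemma cvg_fourier (u th : nat -> R) : cvgn (series (fun j => `|u j|)) ->
  cvgn (series (fun j => (u j)%:C * expi (th j) : R[i]^o)).
Proof.
move=> cu.
have dom (v : nat -> R) : (forall j, `|v j| <= `|u j|) -> cvgn (series v).
  move=> vu; apply: (@normed_cvg _ R^o).
  apply: (series_le_cvg _ _ _ cu) => // j; exact: normr_ge0.
have /cvg_ex[a ca] : cvgn (series (fun j => u j * cos (th j))).
  by apply: dom => j; rewrite normrM ler_piMr// ler_norml cos_geN1 cos_le1.
have /cvg_ex[b cb] : cvgn (series (fun j => u j * sin (th j))).
  by apply: dom => j; rewrite normrM ler_piMr// ler_norml sin_geN1 sin_le1.
apply/cvg_ex; exists (a +i* b : R[i]^o).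
have cab := cvg_complex ca cb.
apply: cvg_trans cab; apply: near_eq_cvg; apply: nearW => N /=; rewrite /series /=.
elim: N => [|N IH]; first by rewrite !big_geq.
by rewrite !big_nat_recr//= -IH /expi; simpc.
Qed.

Lemma esum_subset_le (T : choiceType) (A : set T) (a : T -> \bar R) :
  (forall x, 0 <= a x)%E -> (\esum_(x in A) a x <= \esum_(x in [set: T]) a x)%E.
Proof.
move=> a0; rewrite [leRHS](esumID A)//.
by rewrite !setTI leeDl//; apply: esum_ge0.
Qed.

(** |c r| <= |r c r| at every lag but 0. *)
Lemma summable_acv (c : int -> R) : summable_lag_acv c ->
  summable [set: int] (fun r => (c r)%:E).
Proof.
move=> sc; rewrite /summable (esumID [set 0])//= setTI esum_set1//.
rewrite setTI lte_add_pinfty ?ltry//.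
apply: le_lt_trans sc; apply: le_trans (esum_subset_le (~` [set 0]) _) => //.
apply: le_esum => r /= /eqP r0; rewrite lee_fin normrM ler_peMl//.
by rewrite -intr_norm (ler_int _ 1) -gtz0_ge1 normr_gt0.
Qed.

Lemma summable_acv_half (c : int -> R) (e : nat -> int) : summable_lag_acv c ->
  injective e -> cvgn (series (fun j => `|c (e j)|)).
Proof.
move=> /summable_acv sc einj.
apply: (@summable_cvg R predT (fun j => `|(c (e j))%:E|%E)) => //.
rewrite /summable; under eq_esum do rewrite abse_id.
rewrite -(esum_image _ e (fun r => `|(c r)%:E|%E)); last by move=> i j _ _ /einj.
by apply: le_lt_trans sc; apply: esum_subset_le.
Qed.

(** [Negz j] is the integer - (j + 1). *)
Lemma sum_split_at (V : zmodType) (u : int -> V) (s n : nat) : (s <= n)%N ->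
  \sum_(i < n) u (i%:Z - s%:Z)
    = \sum_(r < n - s) u r%:Z + \sum_(j < s) u (Negz j).
Proof.
move=> sn; rewrite -(subnK sn) addnK addnC big_split_ord /= addrC; congr +%R.
  by apply: eq_bigr => i _; congr u; lia.
rewrite (reindex_inj rev_ord_inj) /=; apply: eq_bigr => i _; congr u.
by have := ltn_ord i; lia.
Qed.

Variables (c : int -> R) (f : R -> R) (w : R).
Hypothesis c_sum : summable_lag_acv c.
Hypothesis c_f : is_spectral_density c f.

Let term (r : int) : R[i] := (c r)%:C * expi (r%:~R * w).

Let cvg_half (e : nat -> int) : injective e ->
  exists A : R[i], (fun N => \sum_(r < N) term (e r) : R[i]^o) @ \oo --> (A : R[i]^o).
Proof.
move=> einj.
have /cvg_ex[A cA] :=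
  @cvg_fourier _ (fun j => (e j)%:~R * w) (summable_acv_half c_sum einj).
exists A; apply: cvg_trans cA; apply: near_eq_cvg; apply: nearW => N /=.
by rewrite /series /= big_mkord.
Qed.

(** The N-th term is the sum of c(tau - s.+1) e^(i tau w) over the window
    - N < tau <= n + N, which grows around the observation times 1, ..., n.  The
    window is not symmetric around s.+1, whereas the spectral density is a limit
    of symmetric sums.  The two one-sided series converge separately, by
    absolute summability, so both limits are the sum of theirs. *)
Lemma cvg_window_sum (n s : nat) : (s < n)%N ->
  (fun N => \sum_(t < n) (c (t.+1%:Z - s.+1%:Z))%:C * expi (t.+1%:R * w)
    + \sum_(j < N) ((c (- j%:Z - s.+1%:Z))%:C * expi ((- j%:Z)%:~R * w)
        + (c ((n + j).+1%:Z - s.+1%:Z))%:C * expi ((n + j).+1%:R * w))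
    : R[i]^o) @ \oo --> (expi (s.+1%:R * w) * (f w)%:C : R[i]^o).
Proof.
move=> sn.
(* A and B are the sums over the nonnegative and over the negative lags. *)
have [A cA] := @cvg_half Posz (fun i j => @congr1 _ _ absz i j).
have [B cB] : exists B : R[i],
    (fun N => \sum_(r < N) term (Negz r) : R[i]^o) @ \oo --> (B : R[i]^o).
  by apply: cvg_half => i j [].
have AB : A + B = (f w)%:C.
  have cf : sumZ_is term (f w)%:C := @c_f w.
  rewrite /sumZ_is in cf.
  apply: cvg_complex_unique cf.
  have cA1 : (fun N => \sum_(r < N.+1) term r%:Z : R[i]^o) @ \oo --> (A : R[i]^o).
    by rewrite -(cvg_shiftS (fun N => \sum_(r < N) term r%:Z : R[i]^o)) in cA.
  apply: cvg_trans (cvgD cA1 cB); apply: near_eq_cvg; apply: nearW => N /=.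
  rewrite fctE (sum_split_at term); last lia.
  by have -> : (N.*2.+1 - N = N.+1)%N by lia.
have cA' := cvg_complex_shift (n - s) cA.
have cB' := cvg_complex_shift s cB.
rewrite -AB.
apply: cvg_trans (cvgMl_tmp (a := expi (s.+1%:R * w) : R[i]) (cvgD cA' cB')).
apply: near_eq_cvg; apply: nearW => N /=; rewrite fctE.
have shift (r t : int) : t = s%:Z + 1 + r ->
  (c r)%:C * expi (t%:~R * w) = expi (s.+1%:R * w) * term r.
  move=> ->; rewrite /term mulrCA -expiD -mulrDl; congr (_ * expi (_ * w)).
  by rewrite !intrD -[s.+1]addn1 natrD.
elim: N => [|N IH].
  rewrite big_ord0 addr0 !add0n -sum_split_at 1?ltnW// mulr_sumr.
  apply: eq_bigr => t _; rewrite -(shift _ t.+1%:Z)//; last lia.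
  by congr ((c _)%:C * _); lia.
rewrite !addSn !big_ord_recr /= addrACA mulrDr [RHS]addrA -IH mulrDr.
rewrite [X in _ + X = _]mulrDr.
rewrite -(shift _ (n + N).+1%:Z); last lia.
rewrite -(shift _ (- N%:Z)); last lia.
rewrite [X in _ + X = _]addrC; congr (_ + (_%:C * _ + _%:C * _)).
- by congr c; lia.
- by congr c; lia.
Qed.

(** Moving the observation times to the right leaves the times outside
    1, ..., n, over which the predictive transform sums. *)
Lemma cvg_outside_sum (n s : nat) : (s < n)%N ->
  (fun N => \sum_(j < N) ((c (- j%:Z - s.+1%:Z))%:C * expi ((- j%:Z)%:~R * w)
        + (c ((n + j).+1%:Z - s.+1%:Z))%:C * expi ((n + j).+1%:R * w)) : R[i]^o)
    @ \oo --> (expi (s.+1%:R * w) * (f w)%:C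
      - \sum_(t < n) (c (t.+1%:Z - s.+1%:Z))%:C * expi (t.+1%:R * w) : R[i]^o).
Proof.
move=> sn; set S := \sum_(t < n) _.
apply: cvg_trans (cvgB (cvg_window_sum sn) (cvg_cst (S : R[i]^o))).
by apply: near_eq_cvg; apply: nearW => N /=; rewrite fctE addrC addKr.
Qed.

End Fourier.

(** * Prediction errors as quadratic forms *)

Section Dot.
Context {R : realType} {n : nat}.
Implicit Types u v : 'rV[R]_n.

Definition dot u v : R := (u *m v^T) 0 0.

Lemma dotE u v : dot u v = \sum_t u 0 t * v 0 t.
Proof. by rewrite /dot mxE; apply: eq_bigr => t _; rewrite mxE. Qed.

Lemma dotC u v : dot u v = dot v u.
Proof. by rewrite !dotE; apply: eq_bigr => t _; rewrite mulrC. Qed.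

Lemma dotDl u1 u2 v : dot (u1 + u2) v = dot u1 v + dot u2 v.
Proof. by rewrite /dot mulmxDl mxE. Qed.

Lemma dotDr u v1 v2 : dot u (v1 + v2) = dot u v1 + dot u v2.
Proof. by rewrite dotC dotDl !(dotC u). Qed.

Lemma dotZl l u v : dot (l *: u) v = l * dot u v.
Proof. by rewrite /dot -scalemxAl mxE. Qed.

Lemma dotZr l u v : dot u (l *: v) = l * dot u v.
Proof. by rewrite dotC dotZl dotC. Qed.

End Dot.

Section Toeplitz.
Context {R : realType}.

(** The coefficients of a predictor are real, so the normal equations live over
    R; [Gamma] is the image of this matrix in R[i]. *)
Definition toeplitz {n} (c : int -> R) : 'M[R]_n :=
  \matrix_(s, t) c (s%:Z - t%:Z).

(** The covariances of X_tau with X_1, ..., X_n when c is the autocovariance of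
    X: the right-hand side of the normal equations. *)
Definition lag_row {n} (c : int -> R) (tau : int) : 'rV[R]_n :=
  \row_s c (tau - s.+1%:Z).

Definition quad_mse {n} (c : int -> R) (tau : int) (a : 'rV[R]_n) : R :=
  c 0 - 2 * dot (lag_row c tau) a + dot (a *m toeplitz c) a.

End Toeplitz.

Section Moments.
Context {R : realType} {d : measure_display} {T : measurableType d}
  (P : probability T R).

Lemma expectation_sqr_sum (I : finType) (Y : I -> T -> R) (al : I -> R)
    (g : I -> I -> R) :
  (forall i, Y i \in Lfun P 2%:E) -> (forall i j, 'E_P[Y i * Y j] = (g i j)%:E)%E ->
  'E_P[(fun w => (\sum_i al i * Y i w) ^+ 2)%R]%E
    = (\sum_i \sum_j al i * al j * g i j)%:E.
Proof.
move=> Y2 Yg.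
pose F (p : I * I) := (al p.1 * al p.2) \o* (Y p.1 * Y p.2).
have F1 p : F p \in Lfun P 1 by rewrite Lfun_scale// Lfun2_mul_Lfun1.
have -> : (fun w => (\sum_i al i * Y i w) ^+ 2) = \sum_(Z <- [seq F p | p : I * I]) Z.
  apply/funext => w; rewrite big_map fct_sumE big_enum /=.
  rewrite expr2 mulr_suml -(pair_bigA _ (fun i j => F (i, j) w)) /=.
  apply: eq_bigr => i _; rewrite mulr_sumr; apply: eq_bigr => j _.
  by rewrite /F /= mulrACA mulrC.
rewrite expectation_sum => [|Z /mapP[p _ ->]]; last exact: F1.
rewrite big_map big_enum /= pair_bigA /= -sumEFin; apply: eq_bigr => -[i j] _.
by rewrite /F expectationZl ?Lfun2_mul_Lfun1//= Yg.
Qed.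

Variables (X : int -> {RV P >-> R}) (c : int -> R).
Hypothesis X_stat : is_stationary_with_acv X c.

Lemma stationary_moment s t : ('E_P[(X s : T -> R) * X t] = (c (s - t))%:E)%E.
Proof.
have X2 := acv_square_integrable X_stat.
have P_fin : P setT \is a fin_num by exact: fin_num_measure.
have := acv_covariance X_stat s t; rewrite covarianceE.
- by rewrite !(acv_zero_mean X_stat) mule0 sube0.
- exact: Lfun_subset12.
- exact: Lfun_subset12.
- exact: Lfun2_mul_Lfun1.
Qed.

Lemma acv_even r : c (- r) = c r.
Proof.
have := stationary_moment 0 r; rewrite mulrC stationary_moment.
by rewrite sub0r subr0 => -[].
Qed.

(** The process enters the prediction error through c alone, which turns
    prediction into the minimization of a quadratic form. *)
Lemma pred_mseE {n} tau (a : 'rV[R]_n) :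
  pred_mse X tau a = (quad_mse c tau a)%:E.
Proof.
(* The error is a combination of n + 1 variables, X_tau with coefficient 1 at
   index 0 and X_t with coefficient - a_t. *)
pose Y (i : 'I_n.+1) := if unlift ord0 i is Some t then X t.+1%:Z else X tau.
pose al (i : 'I_n.+1) := if unlift ord0 i is Some t then - a 0 t else 1.
pose tm (i : 'I_n.+1) := if unlift ord0 i is Some t then t.+1%:Z else tau.
have -> : pred_mse X tau a = 'E_P[(fun w => (\sum_o al o * Y o w) ^+ 2)%R]%E.
  rewrite /pred_mse; congr expectation; apply/funext => w.
  rewrite big_ord_recl /al /Y unlift_none mul1r; congr ((_ + _) ^+ 2).
  by rewrite -sumrN; apply: eq_bigr => t _; rewrite liftK mulNr.
rewrite (expectation_sqr_sum _ (g := fun o p => c (tm o - tm p))).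
- congr (_%:E).
  rewrite /quad_mse !dotE big_ord_recl {1}/al unlift_none big_ord_recl.
  rewrite {1}/al {1 2}/tm !unlift_none subrr !mul1r -!addrA; congr (_ + _).
  rewrite mulr_sumr -sumrN -!big_split /=; apply: eq_bigr => t _.
  rewrite big_ord_recl /al /tm !unlift_none !liftK !mxE.
  rewrite -[in c (t.+1%:Z - tau)]opprB acv_even.
  under eq_bigr do rewrite !liftK.
  under [in RHS]eq_bigr do rewrite !mxE.
  rewrite mulr_suml; set S := \sum_(i < n) _; set S' := \sum_(i < n) _.
  have -> : S = S'.
    apply: eq_bigr => i _; rewrite -[in LHS]opprB acv_even.
    have -> : i.+1%:Z - t.+1%:Z = i%:Z - t%:Z by lia.
    ring.
  ring.
- have X2 := acv_square_integrable X_stat.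
  by move=> i; rewrite /Y; case: unlift => [t|]; exact: X2.
- move=> i j; rewrite -stationary_moment /Y /tm.
  by case: (unlift ord0 i) => [?|]; case: (unlift ord0 j).
Qed.
End Moments.

(** * Normal equations and positive definiteness *)

Section Acv.
Context {R : realType} {n : nat}.
Variable c : int -> R.
Hypothesis c_even : forall r, c (- r) = c r.

Local Notation G := (toeplitz c : 'M[R]_n).
Local Notation lag := (@lag_row R n c).

Lemma toeplitz_sym (u v : 'rV[R]_n) : dot (u *m G) v = dot (v *m G) u.
Proof.
have GT : G^T = G.
  by apply/matrixP => s t; rewrite !mxE -[LHS]c_even opprB.
by rewrite dotC /dot trmx_mul GT mulmxA.
Qed.

(** Completing the square around a solution of the normal equations. *)
Lemma quad_mse_shift tau (a h : 'rV[R]_n) : a *m G = lag tau ->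
  quad_mse c tau (a + h) = quad_mse c tau a + dot (h *m G) h.
Proof.
move=> aG; rewrite /quad_mse mulmxDl !dotDr !dotDl (toeplitz_sym h a) -aG.
by ring.
Qed.

(** G is invariant under reversing both indices, and reversing the time interval
    1, ..., n exchanges tau with n + 1 - tau. *)
Lemma lag_row_rev tau (a : 'rV[R]_n) : a *m G = lag tau ->
  (\row_t a 0 (rev_ord t)) *m G = lag (n%:Z + 1 - tau).
Proof.
move=> aG; apply/rowP => s; move/rowP: aG => /(_ (rev_ord s)).
rewrite !mxE (reindex_inj rev_ord_inj) /= => e.
transitivity (c (tau - (n - s.+1).+1%:Z)); last first.
  by rewrite -c_even; congr c; have := ltn_ord s; lia.
rewrite -e; apply: eq_bigr => t _; rewrite !mxE; congr (_ * _).
by rewrite -c_even; congr c => /=; have := ltn_ord s; have := ltn_ord t; lia.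
Qed.

Hypothesis mse_ge0 : forall tau (a : 'rV[R]_n), 0 <= quad_mse c tau a.

(** Under this hypothesis the error of predicting X_tau by l * y is at most an
    affine function of l, which can be nonnegative for all l only if its slope
    is zero. *)
Lemma dot_lag_eq0 tau (y : 'rV[R]_n) : dot (y *m G) y <= 0 -> dot (lag tau) y = 0.
Proof.
move=> q0; apply/eqP/contraT => b0.
(* At this l the affine part takes the value -1. *)
set l := (c 0 + 1) / (2 * dot (lag tau) y).
have := mse_ge0 tau (l *: y).
rewrite /quad_mse -scalemxAl dotZr dotZl dotZr.
have : l * (l * dot (y *m G) y) <= 0.
  by rewrite mulrA -expr2 mulr_ge0_le0// sqr_ge0.
have -> : 2 * (l * dot (lag tau) y) = c 0 + 1 by rewrite /l; field.
lra.
Qed.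

Hypothesis n_gt0 : (0 < n)%N.
Variable f : R -> R.
Hypothesis c_sum : summable_lag_acv c.
Hypothesis c_f : is_spectral_density c f.
Hypothesis f_neq0 : forall w, f w != 0.

(** Each sum of c(tau - s.+1) y_s over s vanishes, whatever tau in Z; weighting
    by e^(i tau w) and summing over tau gives f(w) times the Fourier transform
    of y. *)
Lemma toeplitz_posdef (y : 'rV[R]_n) : dot (y *m G) y <= 0 -> y = 0.
Proof.
move=> /dot_lag_eq0 y0.
have y0C tau : \sum_(s < n) (y 0 s)%:C * (c (tau - s.+1%:Z))%:C = 0 :> R[i].
  transitivity (dot (lag tau) y)%:C; last by rewrite y0.
  rewrite dotE rmorph_sum /=.
  by apply: eq_bigr => s _; rewrite -rmorphM /= mxE mulrC.
have y0_sum m (tau : nat -> int) (e : nat -> R[i]) :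
    \sum_(s < n) (y 0 s)%:C * (\sum_(t < m) (c (tau t - s.+1%:Z))%:C * e t) = 0.
  under eq_bigr do rewrite mulr_sumr.
  rewrite exchange_big big1//= => t _.
  by under eq_bigr do rewrite mulrA; rewrite -mulr_suml y0C mul0r.
have y_hat (k : 'I_n) : \sum_(s < n) expi (s.+1%:R * freq k) * (y 0 s)%:C = 0 :> R[i].
  have fk : (f (freq k))%:C != 0 :> R[i].
    by rewrite -(rmorph0 (@real_complex R)) (inj_eq (@complexI R)).
  apply: (mulIf fk); rewrite mul0r mulr_suml.
  apply: (cvg_complex_unique (u := fun=> 0)); last exact: (@cvg_cst R[i]^o).
  have := cvg_lincomb (a := fun s => (y 0 s)%:C)
    (fun s : 'I_n => cvg_window_sum (w := freq k) c_sum c_f (ltn_ord s)).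
  under [X in _ --> X]eq_bigr do rewrite mulrCA mulrA.
  apply: cvg_trans; apply: near_eq_cvg; apply: nearW => N /=.
  under eq_bigr do rewrite big_split /= !mulrDr.
  rewrite !big_split /=.
  rewrite (y0_sum _ (fun t => t.+1%:Z)
    (fun t => expi (t.+1%:R * freq k))).
  rewrite (y0_sum _ (fun j => - j%:Z)
    (fun j => expi ((- j%:Z)%:~R * freq k))).
  rewrite (y0_sum _ (fun j => (n + j).+1%:Z)
    (fun j => expi ((n + j).+1%:R * freq k))).
  by rewrite !addr0.
have Fy : DFT n *m (map_mx (@real_complex R) y)^T = 0.
  apply/matrixP => k j; rewrite !mxE.
  transitivity ((Num.sqrt n%:R)^-1%:C *
      (\sum_(s < n) expi (s.+1%:R * freq k) * (y 0 s)%:C)); last first.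
    by rewrite y_hat mulr0.
  rewrite mulr_sumr; apply: eq_bigr => s _.
  by rewrite !mxE !ord1 -!mulrA.
have : (map_mx (@real_complex R) y)^T = 0.
  by rewrite -[LHS]mul1mx -(mulmx1C (DFT_unitary n_gt0)) -mulmxA Fy mulmx0.
by move/(congr1 trmx); rewrite trmxK trmx0 => /eqP; rewrite map_mx_eq0 => /eqP.
Qed.

Lemma toeplitz_unit : G \in unitmx.
Proof.
rewrite -row_free_unit; apply: inj_row_free => y yG.
by apply: toeplitz_posdef; rewrite yG /dot mul0mx mxE.
Qed.

End Acv.

(** * The predictive discrete Fourier transform *)

Section Predictor.
Context {R : realType} {d : measure_display} {T : measurableType d}
  (P : probability T R).
Variables (X : int -> {RV P >-> R}) (c : int -> R) (f : R -> R) (n : nat).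
Hypothesis n_gt0 : (0 < n)%N.
Hypothesis X_spec : has_regular_spectrum X c f.

Local Notation G := (toeplitz c : 'M[R]_n).
Local Notation lag := (@lag_row R n c).

Let c_even := acv_even (spec_stationary X_spec).
Let c_sum := spec_summable X_spec.
Let c_f := spec_density X_spec.

Let mse_ge0 tau (a : 'rV[R]_n) : 0 <= quad_mse c tau a.
Proof.
rewrite -lee_fin -(pred_mseE (spec_stationary X_spec)).
by apply: expectation_ge0 => w; exact: sqr_ge0.
Qed.

Let f_neq0 w : f w != 0.
Proof.
have [delta delta_gt0 f_ge] := spec_away0 X_spec.
by rewrite gt_eqF// (lt_le_trans delta_gt0).
Qed.

Let posdef := toeplitz_posdef mse_ge0 n_gt0 c_sum c_f f_neq0.

Let G_unit : G \in unitmx := toeplitz_unit mse_ge0 n_gt0 c_sum c_f f_neq0.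

Lemma best_linear_predictorP tau (a : 'rV[R]_n) :
  is_best_linear_predictor X tau a <-> a = lag tau *m invmx G.
Proof.
set a0 := lag tau *m invmx G.
have mseE b : pred_mse X tau b
    = (quad_mse c tau a0 + dot ((b - a0) *m G) (b - a0))%:E.
  rewrite (pred_mseE (spec_stationary X_spec)) -quad_mse_shift ?mulmxKV//.
  by rewrite addrC subrK.
split=> [a_best|-> b].
  apply/eqP; rewrite -subr_eq0; apply/eqP/posdef.
  move: (a_best a0); rewrite !mseE subrr {2}/dot trmx0 mulmx0 mxE addr0 lee_fin.
  by rewrite gerDl.
rewrite !mseE subrr {1}/dot trmx0 mulmx0 mxE addr0 lee_fin lerDl leNgt.
apply/negP => h; move: (h); rewrite (posdef (ltW h)).
by rewrite /dot trmx0 mulmx0 mxE ltxx.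
Qed.

Lemma blp_coefE tau : blp_coef X n tau = lag tau *m invmx G.
Proof.
apply/best_linear_predictorP; rewrite /blp_coef; case: xgetP => // none.
by case: (none (lag tau *m invmx G)); apply/best_linear_predictorP.
Qed.

Lemma Gamma_map : Gamma n c = map_mx (@real_complex R) G.
Proof. by apply/matrixP => s t; rewrite !mxE. Qed.

(** The backward coefficients of X_(-j) are the coefficients of X_(n+j+1), and
    their weight e^(i(j+1)w) equals e^(i(n+j+1)w) at the Fourier frequencies. *)
Lemma D_termE (k t : 'I_n) (j : nat) : D_term X k t (- j%:Z)
  = \sum_s (invmx (Gamma n c) s t) *
    ((c (- j%:Z - s.+1%:Z))%:C * expi ((- j%:Z)%:~R * freq k)
     + (c ((n + j).+1%:Z - s.+1%:Z))%:C * expi ((n + j).+1%:R * freq k)).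
Proof.
have blpE tau : (blp_coef X n tau 0 t)%:C
    = \sum_s invmx (Gamma n c) s t * (c (tau - s.+1%:Z))%:C.
  rewrite blp_coefE Gamma_map -map_invmx mxE rmorph_sum; apply: eq_bigr => s _.
  by rewrite rmorphM !mxE mulrC.
have -> : D_term X k t (- j%:Z) =
    (blp_coef X n (- j%:Z) 0 t)%:C * expi ((- j%:Z)%:~R * freq k)
    + (blp_coef X n (n + j).+1%:Z 0 t)%:C * expi ((n + j).+1%:R * freq k).
  rewrite /D_term; congr (_ + _%:C * _).
    have -> : (n + j).+1%:Z = n%:Z + 1 - - j%:Z by lia.
    have aG : blp_coef X n (- j%:Z) *m G = lag (- j%:Z).
      by rewrite blp_coefE mulmxKV.
    by rewrite [in RHS]blp_coefE -(lag_row_rev c_even aG) mulmxK// mxE.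
  rewrite -addnS natrD mulrDl expiD (freq_period n_gt0) mul1r; congr (expi (_ * _)).
  by rewrite -intrN -[RHS]/(j.+1%:Z%:~R); congr (_%:~R); lia.
rewrite !blpE !mulr_suml -big_split; apply: eq_bigr => s _ /=.
by rewrite mulrDr !mulrA.
Qed.

Lemma D_series_cvg (k t : 'I_n) :
  D_series X k t @ \oo -->
    (\sum_s invmx (Gamma n c) s t *
       (expi (s.+1%:R * freq k) * (f (freq k))%:C
        - \sum_(r < n) (c (r.+1%:Z - s.+1%:Z))%:C * expi (r.+1%:R * freq k))
      : R[i]^o).
Proof.
apply: cvg_trans (cvg_lincomb (a := fun s => invmx (Gamma n c) s t)
  (fun s => cvg_outside_sum (w := freq k) c_sum c_f (ltn_ord s))).
apply: near_eq_cvg; apply: nearW => N /=; rewrite /D_series /series /= big_mkord.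
under [RHS]eq_bigr do rewrite D_termE.
by rewrite exchange_big /=; apply: eq_bigr => s _; rewrite -mulr_sumr.
Qed.

Lemma Gamma_unit : Gamma n c \in unitmx.
Proof. by rewrite Gamma_map map_unitmx. Qed.

(** Every phi(tau) has the form (c(tau - s))_s G^-1, so D is G^-1 applied to
    the Fourier sums of c over the times outside 1, ..., n; normalized by
    n^(-1/2), these form Delta(f) F - F G. *)
Lemma D_mxE : D_mx X n = Delta n f *m DFT n *m invmx (Gamma n c) - DFT n.
Proof.
rewrite -[X in _ - X](mulmxK Gamma_unit) -mulmxBl.
apply/matrixP => k t; rewrite mxE.
rewrite (cvg_lim (@norm_hausdorff _ _) (@D_series_cvg k t)) !mxE mulr_sumr.
apply: eq_bigr => s _; rewrite mulrCA mulrC; congr (_ * _).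
rewrite mul_diag_mx !mxE mulrBr mulr_sumr; congr (_ - _).
  by rewrite mulrA [LHS]mulrC.
apply: eq_bigr => r _; rewrite !mxE mulrCA mulrC; congr (_ * (c _)%:C); lia.
Qed.

Lemma inverse_toeplitz_DFT : invmx (Gamma n c)
  = (DFT n) ^t* *m Delta n (fun w => (f w)^-1) *m (DFT n + D_mx X n).
Proof.
rewrite D_mxE addrC subrK !mulmxA -(mulmxA _ (Delta _ _) (Delta _ _)).
rewrite mulmx_diag [X in diag_mx X](_ : _ = const_mx 1); last first.
  by apply/rowP => k; rewrite !mxE -rmorphM mulVf.
by rewrite diag_const_mx mulmx1 (mulmx1C (DFT_unitary n_gt0)) mul1mx.
Qed.

End Predictor.

Unset Implicit Arguments.

Theorem corollary2p1 (R : realType) (n : nat) (n_gt0 : (0 < n)%N) :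
  (forall (d : measure_display) (T : measurableType d) (P : probability T R)
      (X : int -> {RV P >-> R}) (c : int -> R) (f : R -> R),
    has_regular_spectrum X c f ->
    [/\ Gamma n c \in unitmx,
        forall tau : int, tau <= 0 ->
          exists! a : 'rV[R]_n, is_best_linear_predictor X tau a,
        forall k t : 'I_n,
          cvgn (D_series X k t)
      & invmx (Gamma n c)
        = (DFT n) ^t* *m Delta n (fun w => (f w)^-1) *m (DFT n + D_mx X n)])
  /\
  (forall (d1 : measure_display) (T1 : measurableType d1)
      (P1 : probability T1 R) (X1 : int -> {RV P1 >-> R})
      (c1 : int -> R) (f1 : R -> R)
      (d2 : measure_display) (T2 : measurableType d2)
      (P2 : probability T2 R) (X2 : int -> {RV P2 >-> R})
      (c2 : int -> R) (f2 : R -> R),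
    has_regular_spectrum X1 c1 f1 ->
    has_regular_spectrum X2 c2 f2 ->
    (forall r : int, `|r| <= n%:Z - 1 -> c1 r = c2 r) ->
    [/\ invmx (Gamma n c1)
        = (DFT n) ^t* *m Delta n (fun w => (f1 w)^-1) *m (DFT n + D_mx X1 n),
        (DFT n) ^t* *m Delta n (fun w => (f1 w)^-1) *m (DFT n + D_mx X1 n)
        = (DFT n) ^t* *m Delta n (fun w => (f2 w)^-1) *m (DFT n + D_mx X2 n)
      & (DFT n) ^t* *m Delta n (fun w => (f2 w)^-1) *m (DFT n + D_mx X2 n)
        = invmx (Gamma n c2)]).
Proof.
have one (d : measure_display) (T : measurableType d) (P : probability T R)
    (X : int -> {RV P >-> R}) (c : int -> R) (f : R -> R)
    (X_spec : has_regular_spectrum X c f) := inverse_toeplitz_DFT n_gt0 X_spec.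
split=> [d T P X c f X_spec|].
  split; first exact: Gamma_unit X_spec.
  - move=> tau _; exists (lag_row c tau *m invmx (toeplitz c)); split.
      exact/(best_linear_predictorP n_gt0 X_spec).
    by move=> a /(best_linear_predictorP n_gt0 X_spec) ->.
  - by move=> k t; apply/cvg_ex; eexists; apply: D_series_cvg X_spec _ _.
  - exact: one.
move=> d1 T1 P1 X1 c1 f1 d2 T2 P2 X2 c2 f2 X1_spec X2_spec c12.
have Gamma12 : Gamma n c1 = Gamma n c2 :> 'M[R[i]]_n.
  apply/matrixP => s t; rewrite !mxE c12//.
  by have := ltn_ord s; have := ltn_ord t; lia.
by split; rewrite -?(one _ _ _ _ _ _ X1_spec) -?(one _ _ _ _ _ _ X2_spec) ?Gamma12.
Qed.
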